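(* Let $k\ge 3$ and $a_1,\dots,a_k\in\mathbb{Z}\setminus\{0\}$, with at least one $a_i$ positive and at least one negative. Then there exists $\delta>0$ such that for all sufficiently large $n$, every 2-coloring of $[n]$ has at least $\delta n^{k-1}$ monochromatic solutions to $a_1x_1+\dots+a_kx_k=0$, i.e. at least $\delta n^{k-1}$ tuples $(x_1,\dots,x_k)\in[n]^k$ satisfying the equation whose entries all receive the same color.
   Context: $[n]=\{1,\dots,n\}$. *)

(* Defs.v *)
From mathcomp Require Import all_boot all_order all_algebra.
From mathcomp Require Import reals.

Set Implicit Arguments.
Unset Strict Implicit.
Unset Printing Implicit Defensive.

Import GRing.Theory.
Local Open Scope ring_scope.

(* The set [n] = {1, ..., n} is represented by 'I_n = {0, ..., n - 1}: the
   ordinal i stands for the integer i + 1. *)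
Definition elt (n : nat) (i : 'I_n) : int := (i.+1)%:Z.

Definition is_solution (k n : nat) (a : 'I_k -> int) (x : {ffun 'I_k -> 'I_n}) :
  bool := \sum_(i < k) a i * elt (x i) == 0.

Definition monochromatic (k n : nat) (c : 'I_n -> bool)
    (x : {ffun 'I_k -> 'I_n}) : bool :=
  [forall i, forall j, c (x i) == c (x j)].

Definition mono_solutions (k n : nat) (a : 'I_k -> int) (c : 'I_n -> bool) :
  {set {ffun 'I_k -> 'I_n}} :=
  [set x | is_solution a x && monochromatic c x].

(* Main.v *)
Require Import Defs.
From mathcomp Require Import all_boot all_order all_algebra perm.
From mathcomp Require Import reals zify ring.

(** The key observation is an exchange argument. Fix an index [i0] and
    suppose that for every [l != i0] there are a red number [x l] and a blue
    number [x l + y l], where [\sum_(l != i0) a l * y l = 0]. The red tuple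
    and the blue tuple are completed to a solution by the same entry at
    [i0], so one of the two completions is monochromatic, whatever the
    colour of that entry.

    Such pairs come from a grid of solutions with one direction for each
    index. If no solution of the grid is monochromatic, each of them has an
    entry, at [d] say, whose colour differs from that of the entry at [i0].
    By pigeonhole, the same [d] and the same two colours occur often on some
    line in direction [d], and along such a line the difference between the
    entries at [d] and [i0] is constant. Cut the segments joining these two
    entries, one for each [l], into steps of lengths that balance the
    equation: on each segment some step changes colour. Different points of
    the line are multiplied by factors growing so fast that the largest
    entry of the tuple forces the completing entry to be positive.

    To get [n ^ (k - 1)] solutions rather than one, the grid depends on
    integer parameters ranging over [0, m], with [m] proportional to [n],
    and each of the finitely many possible monochromatic solutions
    determines [k - 1] of the parameters in terms of the other ones. *)

Set Implicit Arguments.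
Unset Strict Implicit.
Unset Printing Implicit Defensive.

Import Order.TTheory GRing.Theory Num.Theory.
Local Open Scope ring_scope.

Lemma pigeonhole (X Y : finType) (f : X -> Y) (A : {set X}) (B : {set Y})
    (q : nat) :
  {in A, forall x, f x \in B} -> (#|B| * q < #|A|)%N ->
  exists2 y, y \in B & (q < #|[set x in A | f x == y]|)%N.
Proof.
move=> fAB ltqA; apply/exists_inP; apply: contraLR ltqA.
rewrite negb_exists_in -leqNgt => /forall_inP fibre_le.
rewrite -sum1_card (partition_big f (mem B)) //= -sum_nat_const.
apply: leq_sum => y /fibre_le; rewrite -leqNgt; apply: leq_trans.
by rewrite sum1_card subset_leq_card //; apply/subsetP => x; rewrite inE.
Qed.

Lemma card_ffun_determined (I T : finType) (A : {set I})
    (W : {set {ffun I -> T}}) :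
  {in W &, forall w w' : {ffun I -> T}, {in A, w =1 w'} -> w = w'} ->
  (#|W| <= #|T| ^ #|A|)%N.
Proof.
move=> W_det.
pose restrict (w : {ffun I -> T}) := [ffun i : {i | i \in A} => w (val i)].
have := @leq_card_in _ _ restrict (mem W); rewrite card_ffun card_sig; apply.
move=> w w' wW w'W /ffunP eq_w; apply: W_det => // i iA.
by have := eq_w (exist _ i iA); rewrite !ffunE.
Qed.

Section GridLines.

Variables (D S : finType).
Implicit Types (g : {ffun D -> S}) (d : D) (t : S).

Definition relocate g d t : {ffun D -> S} :=
  [ffun e => if e == d then t else g e].

Lemma relocateK g d t : relocate (relocate g d t) d (g d) = g.
Proof. by apply/ffunP => e; rewrite !ffunE; have [->|] := eqVneq. Qed.

Lemma exists_large_line_section (C : {set {ffun D -> S}}) d (r : nat) :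
  (#|S| ^ #|D|.-1 * r < #|C|)%N ->
  exists g, (r < #|[set t | relocate g d t \in C]|)%N.
Proof.
move=> ltC; have /card_gt0P[g0 _] : (0 < #|C|)%N by apply: leq_ltn_trans ltC.
pose origin := g0 d; pose bases := [set g : {ffun D -> S} | g d == origin].
have bases_le : (#|bases| <= #|S| ^ #|D|.-1)%N.
  rewrite -(cardsC1 d); apply: card_ffun_determined => g g'.
  rewrite !inE => /eqP gd /eqP g'd eq_g; apply/ffunP => e.
  by have [->|ne] := eqVneq e d; [rewrite gd g'd | rewrite eq_g ?in_setC1].
have [||g _ lt_r] := @pigeonhole _ _
    (fun g : {ffun D -> S} => relocate g d origin) C bases r.
- by move=> g _; rewrite inE ffunE eqxx.
- by apply: leq_ltn_trans ltC; rewrite leq_mul2r bases_le orbT.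
exists g; apply: leq_trans lt_r _.
rewrite -(card_in_imset (f := fun g' : {ffun D -> S} => g' d)) => [|g1 g2].
  apply: subset_leq_card; apply/subsetP => _ /imsetP[g' + ->].
  by rewrite !inE => /andP[g'C /eqP <-]; rewrite relocateK.
rewrite !inE => /andP[_ /eqP eq1] /andP[_ /eqP eq2] eq_d.
by rewrite -(relocateK g1 d origin) eq1 -eq2 eq_d relocateK.
Qed.

Lemma exists_line_repeating_value (F : finType) (ty : {ffun D -> S} -> F)
    (dir : F -> D) (r : nat) :
  (#|F| * r < #|S|)%N ->
  exists f g, (r < #|[set t | ty (relocate g (dir f) t) == f]|)%N.
Proof.
move=> ltFrS.
have /card_gt0P[t0 _] : (0 < #|S|)%N by apply: leq_ltn_trans ltFrS.
have D_gt0 : (0 < #|D|)%N by apply/card_gt0P; exists (dir (ty [ffun=> t0])).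
have [//||f _] := @pigeonhole _ _ ty setT setT (#|S| ^ #|D|.-1 * r).
  rewrite !cardsT card_ffun -[X in (_ < _ ^ X)%N](prednK D_gt0) expnS.
  rewrite mulnCA mulnC ltn_pmul2r // expn_gt0; apply/orP; left.
  by apply/card_gt0P; exists t0.
move=> /(exists_large_line_section (dir f))[g lt_r]; exists f, g.
by apply: leq_trans lt_r (subset_leq_card _); apply/subsetP => t; rewrite !inE.
Qed.

End GridLines.

Lemma exists_switch (P : pred nat) (n : nat) :
  P 0%N -> ~~ P n -> exists2 s, (s < n)%N & P s && ~~ P s.+1.
Proof.
elim: n => [->//|n IHn] P0 notPn1.
have [Pn|notPn] := boolP (P n); first by exists n => //; rewrite Pn.
by have [s lt_sn Ps] := IHn P0 notPn; exists s => //; apply: ltnW.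
Qed.

Lemma injection_maximal_at (J : finType) (T : nat) (A : {set 'I_T}) (i : J) :
  (#|J| <= #|A|)%N ->
  exists f : {ffun J -> 'I_T}, [/\ injective f, forall j, f j \in A &
    forall j, j != i -> (f j < f i)%N].
Proof.
move=> leJA; pose f0 j := enum_val (widen_ord leJA (enum_rank j)).
have f0_inj : injective f0.
  by move=> j j' /enum_val_inj /(congr1 val) /= /val_inj /enum_rank_inj.
have [i' _ f0_max] := @arg_maxnP _ i predT (fun j => f0 j : nat) isT.
have f_inj : injective (fun j => f0 (tperm i i' j)) := inj_comp f0_inj perm_inj.
exists [ffun j => f0 (tperm i i' j)]; split=> [j j'|j|j ji]; rewrite !ffunE.
- exact: f_inj.
- exact: enum_valP.
rewrite ltn_neqAle (inj_eq val_inj) (inj_eq f_inj) ji tpermL; exact: f0_max.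
Qed.

Lemma barycenter_bounds (R : numDomainType) (n s x y lo hi : R) :
  0 <= s <= n -> lo <= x <= hi -> lo <= y <= hi ->
  n * lo <= (n - s) * x + s * y <= n * hi.
Proof.
move=> /andP[s_ge0 s_le] /andP[lo_x x_hi] /andP[lo_y y_hi].
have split_n z : n * z = (n - s) * z + s * z by rewrite -mulrDl subrK.
by rewrite !split_n !lerD // ler_wpM2l ?subr_ge0.
Qed.

Section LinearEquation.

Variables (R : realDomainType) (J : finType) (a : J -> R).
Implicit Types (P : pred J) (i j l : J) (x y : J -> R) (N : R).

Definition coef_norm : R := \sum_j `|a j|.

Lemma sum_norm_coef_le P : \sum_(j | P j) `|a j| <= coef_norm.
Proof. by rewrite /coef_norm [leRHS](bigID P) lerDl sumr_ge0. Qed.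

Lemma norm_coef_le j : `|a j| <= coef_norm.
Proof. by have := sum_norm_coef_le (pred1 j); rewrite big_pred1_eq. Qed.

Lemma norm_lincomb_le P x N :
  (forall j, P j -> `|x j| <= N) ->
  `|\sum_(j | P j) a j * x j| <= (\sum_(j | P j) `|a j|) * N.
Proof.
move=> x_le; apply: le_trans (ler_norm_sum _ _ _) _.
by rewrite mulr_suml ler_sum // => j /x_le; rewrite normrM; apply: ler_wpM2l.
Qed.

Lemma dominated_lincomb_lt0 P x i :
  P i -> a i < 0 -> 0 < x i ->
  (forall j, P j -> j != i -> coef_norm * `|x j| <= `|a i| * x i) ->
  \sum_(j | P j) a j * x j < 0.
Proof.
move=> Pi ai_lt0 xi_gt0 dom; rewrite (bigD1 i) //=; set rest := \sum_(_ | _) _.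
have ai_gt0 : 0 < `|a i| by rewrite normr_gt0 lt_eqF.
have norm_gt0 : 0 < coef_norm := lt_le_trans ai_gt0 (norm_coef_le i).
have rest_le : coef_norm * `|rest| <=
    (\sum_(j | P j && (j != i)) `|a j|) * (`|a i| * x i).
  rewrite -{1}(gtr0_norm norm_gt0) -normrM mulr_sumr.
  under eq_bigr do rewrite mulrCA.
  apply: norm_lincomb_le => j /andP[Pj ji].
  by rewrite normrM (gtr0_norm norm_gt0) dom.
have others_lt : \sum_(j | P j && (j != i)) `|a j| < coef_norm.
  apply: lt_le_trans (sum_norm_coef_le P).
  by rewrite [ltRHS](bigD1 i) //= ltrDr.
have : coef_norm * `|rest| < coef_norm * (`|a i| * x i).
  by apply: le_lt_trans rest_le _; rewrite ltr_pM2r // mulr_gt0.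
rewrite ltr_pM2l // (ltr0_norm ai_lt0) mulNr => norm_rest_lt.
by rewrite -ltrBrDl sub0r; apply: le_lt_trans (ler_norm _) norm_rest_lt.
Qed.

Lemma solution_scale (c : R) x :
  \sum_j a j * x j = 0 -> \sum_j a j * (c * x j) = 0.
Proof.
by move=> x0; under eq_bigr do rewrite mulrCA; rewrite -mulr_sumr x0 mulr0.
Qed.

Definition completion i x l : R :=
  if l == i then - \sum_(j | j != i) a j * x j else a i * x l.

Lemma completion_pivot i x : completion i x i = - \sum_(j | j != i) a j * x j.
Proof. by rewrite /completion eqxx. Qed.

Lemma completion_neq i x l : l != i -> completion i x l = a i * x l.
Proof. by rewrite /completion => /negbTE ->. Qed.

Lemma eq_completion i x y : x =1 y -> completion i x =1 completion i y.
Proof.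
by move=> eq_xy l; rewrite /completion eq_xy; under eq_bigr do rewrite eq_xy.
Qed.

Lemma completion_solution i x : \sum_l a l * completion i x l = 0.
Proof.
rewrite (bigD1 i) //= completion_pivot mulrN mulr_sumr.
rewrite [X in _ + X](eq_bigr (fun j => a i * (a j * x j))) ?addNr // => j ji.
by rewrite completion_neq // mulrCA.
Qed.

Lemma norm_completion_le i x N l :
  (forall j, `|x j| <= N) -> `|completion i x l| <= coef_norm * N.
Proof.
move=> x_le; have N_ge0 : 0 <= N by apply: le_trans (x_le i).
rewrite /completion; case: eqP => _; last first.
  by rewrite normrM ler_pM ?norm_coef_le.
rewrite normrN; apply: le_trans (norm_lincomb_le (N := N) _) _ => //.
by rewrite ler_wpM2r // sum_norm_coef_le.
Qed.

Definition pos_mass P : R := \sum_(j | P j && (0 < a j)) a j.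
Definition neg_mass P : R := - \sum_(j | P j && ~~ (0 < a j)) a j.

(* Weighting each positive coefficient by the total negative mass and vice versa
   balances the sum; [weight * coweight] does not depend on the index. *)
Definition weight P l : R := if 0 < a l then neg_mass P else pos_mass P.
Definition coweight P l : R := if 0 < a l then pos_mass P else neg_mass P.

Lemma weightM P l : weight P l * coweight P l = pos_mass P * neg_mass P.
Proof. by rewrite /weight /coweight; case: ifP => // _; rewrite mulrC. Qed.

Lemma weight_solution P : \sum_(l | P l) a l * weight P l = 0.
Proof.
rewrite (bigID (fun l => 0 < a l)) /=.
rewrite (eq_bigr (fun l => a l * neg_mass P)); last first.
  by move=> l /andP[_ al]; rewrite /weight al.
rewrite [X in _ + X](eq_bigr (fun l => a l * pos_mass P)); last first.
  by move=> l /andP[_ al]; rewrite /weight (negbTE al).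
by rewrite -!mulr_suml -/(pos_mass P) /neg_mass; ring.
Qed.

Lemma pos_mass_bounds P i : P i -> 0 < a i -> 0 < pos_mass P <= coef_norm.
Proof.
move=> Pi ai_gt0; apply/andP; split.
  rewrite /pos_mass (bigD1 i) ?Pi //= ltr_wpDr ?sumr_ge0 // => j.
  by case/andP=> /andP[_ /ltW].
apply: le_trans (sum_norm_coef_le (fun j => P j && (0 < a j))).
by apply: ler_sum => j _; apply: ler_norm.
Qed.

Lemma neg_mass_bounds P i : P i -> a i < 0 -> 0 < neg_mass P <= coef_norm.
Proof.
move=> Pi ai_lt0; rewrite /neg_mass -sumrN; apply/andP; split.
  rewrite (bigD1 i) /= ?Pi -?leNgt ?ltW // ltr_wpDr ?oppr_gt0 ?sumr_ge0 // => j.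
  by case/andP=> /andP[_]; rewrite -leNgt oppr_ge0.
apply: le_trans (sum_norm_coef_le (fun j => P j && ~~ (0 < a j))).
by apply: ler_sum => j _; rewrite -normrN ler_norm.
Qed.

Lemma weight_bounds P i j l : P i -> 0 < a i -> P j -> a j < 0 ->
  0 < weight P l <= coef_norm.
Proof.
move=> Pi ai Pj aj; rewrite /weight.
by case: ifP => _; [apply: neg_mass_bounds aj | apply: pos_mass_bounds ai].
Qed.

Lemma coweight_bounds P i j l : P i -> 0 < a i -> P j -> a j < 0 ->
  0 < coweight P l <= coef_norm.
Proof.
move=> Pi ai Pj aj; rewrite /coweight.
by case: ifP => _; [apply: pos_mass_bounds ai | apply: neg_mass_bounds aj].
Qed.

Definition unicolored (col : R -> bool) x : Prop :=
  exists r, forall j, col (x j) = r.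

(* On each progression some step changes colour. Replacing the starting points
   of these steps by their end points does not affect the entry at [i] of the
   completion, so that entry shares its colour with one of the two tuples. *)
Lemma unicolored_completion (col : R -> bool) i x y (n : J -> nat) (r : bool) :
  \sum_(j | j != i) a j * y j = 0 ->
  (forall j, col (a i * x j) = r /\ col (a i * (x j + y j *+ n j)) = ~~ r) ->
  exists2 s : J -> nat, forall j, (s j <= n j)%N &
    unicolored col (completion i (fun j => x j + y j *+ s j)).
Proof.
move=> y0 ends; pose z (s : J -> nat) j := x j + y j *+ s j.
have /fin_all_exists2[s s_lt /all_and2[s_r s1_r]] : forall j, exists2 s,
    (s < n j)%N & col (a i * (x j + y j *+ s)) = r /\
                  col (a i * (x j + y j *+ s.+1)) = ~~ r.
  move=> j; have [col0 coln] := ends j.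
  have [||s lt_s /andP[/eqP s_r s1_r]] :=
    @exists_switch (fun s => col (a i * (x j + y j *+ s)) == r) (n j).
  - by rewrite mulr0n addr0 col0.
  - by rewrite coln; case: (r).
  by exists s => //; split=> //; move: s1_r; case: (col _); case: (r).
have pivot_eq : completion i (z (fun j => (s j).+1)) i = completion i (z s) i.
  apply/eqP; rewrite !completion_pivot eqr_opp -subr_eq0 -sumrB; apply/eqP.
  by rewrite -[RHS]y0; apply: eq_bigr => j _; rewrite /z mulrS; ring.
have [eq_r|ne_r] := eqVneq (col (completion i (z s) i)) r.
  exists s => [j|]; [exact: ltnW | exists r => l].
  by have [->|/(completion_neq _)->] := eqVneq l i; [exact: eq_r | exact: s_r].
exists (fun j => (s j).+1) => //; exists (~~ r) => l.
have [->|/(completion_neq _)->] := eqVneq l i; last exact: s1_r.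
by rewrite [completion _ _ _]pivot_eq; move: ne_r; case: (col _); case: (r).
Qed.

End LinearEquation.

Section Determines.

Variables (I T J : finType) (V : Type).

(* For a linear map [x] this is an elementary way to say that its rank is at
   least [d]. *)
Definition determines (d : nat) (x : {ffun I -> T} -> J -> V) : Prop :=
  exists2 A : {set I}, #|A| = d &
    forall w w', x w =1 x w' -> {in ~: A, w =1 w'} -> w = w'.

Lemma determines_entries (B : {set J}) (h : J -> I)
    (x : {ffun I -> T} -> J -> V) :
  injective h ->
  (forall w w', x w =1 x w' -> (forall k, k \notin h @: B -> w k = w' k) ->
     {in B, forall l, w (h l) = w' (h l)}) ->
  determines #|B| x.
Proof.
move=> h_inj x_det; exists (h @: B); first by rewrite card_imset.
move=> w w' eq_x eq_off.
have {}eq_off k : k \notin h @: B -> w k = w' k.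
  by move=> kB; rewrite eq_off ?in_setC.
apply/ffunP => k; have [/imsetP[l lB ->]|/eq_off //] := boolP (k \in h @: B).
exact: x_det lB.
Qed.

Lemma card_fibre_le d (x : {ffun I -> T} -> J -> V) (W : {set {ffun I -> T}})
    (y : J -> V) :
  determines d x -> {in W, forall w, x w =1 y} ->
  (#|W| <= #|T| ^ (#|I| - d))%N.
Proof.
move=> [A <- x_det] xW; rewrite -(cardsC A) addKn.
apply: card_ffun_determined => w w' wW w'W; apply: x_det => l.
by rewrite (xW w) // (xW w').
Qed.

Lemma determines_le d (x : {ffun I -> T} -> J -> V) :
  determines d x -> (d <= #|I|)%N.
Proof. by case=> A <- _; apply: max_card. Qed.

Lemma leq_card_determines (L Y : finType) (d : nat)
    (x : L -> {ffun I -> T} -> J -> V) (val : Y -> J -> V) (S : {set Y}) :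
  (0 < #|T|)%N ->
  (forall w, exists2 lab, determines d (x lab) &
     exists2 y, y \in S & x lab w =1 val y) ->
  (#|T| ^ d <= #|L| * #|S|)%N.
Proof.
move=> /card_gt0P[t0 _] covered; rewrite leqNgt; apply/negP => lt_T.
have /fin_all_exists2[lab lab_det /fin_all_exists2[y yS y_val]] := covered.
pose q := (#|T| ^ (#|I| - d))%N.
have q_gt0 : (0 < q)%N.
  by rewrite expn_gt0; apply/orP; left; apply/card_gt0P; exists t0.
have [||[lab' y'] _] :=
  @pigeonhole _ _ (fun w => (lab w, y w)) setT (setX setT S) q.
- by move=> w _; rewrite in_setX inE yS.
- rewrite cardsX !cardsT card_ffun.
  by rewrite -(subnKC (determines_le (lab_det [ffun=> t0]))) expnD ltn_pmul2r.
apply/negP; rewrite -leqNgt; set W := [set w in _ | _].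
have [->|[w]] := set_0Vmem W; first by rewrite cards0.
rewrite inE => /andP[_ /eqP[lab_w _]]; have := lab_det w; rewrite lab_w => det.
apply: (card_fibre_le (y := val y') det) => w'.
by rewrite inE => /andP[_ /eqP[<- <-]]; apply: y_val.
Qed.

End Determines.

Definition solution_family (J : finType) (a : J -> int) (I : finType) (m : nat)
    (C : int) (x : {ffun I -> 'I_m.+1} -> J -> int) : Prop :=
  [/\ forall w, \sum_l a l * x w l = 0,
      forall w l, 0 < x w l <= C * m.+1%:Z & determines #|J|.-1 x].

Section Configuration.

Variables (J : finType) (a : J -> int) (i0 i1 i2 : J).
Hypotheses (a0_gt0 : 0 < a i0) (a1_gt0 : 0 < a i1) (a2_lt0 : a i2 < 0).
Hypothesis (i1_neq_i0 : i1 != i0).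

Local Notation alpha := (coef_norm a).
Local Notation others := (predC1 i0).

Let i2_neq_i0 : i2 != i0.
Proof. by apply: contraTneq a2_lt0 => ->; rewrite -leNgt ltW. Qed.

Let alpha_gt0 : 0 < alpha.
Proof. by have := norm_coef_le a i0; lia. Qed.

Definition pivot (d : J) : J := if d == i1 then i2 else i1.

(* Adding a multiple of [shift d] to a solution preserves the difference between
   the entries at [d] and [i0]. *)
Definition shift (d : J) : J -> int :=
  completion a (pivot d) (fun j => ((j == i0) || (j == d))%:R).

Lemma shift_solution d : \sum_l a l * shift d l = 0.
Proof. exact: completion_solution. Qed.

Lemma shift_agree d : shift d d = a (pivot d) /\ shift d i0 = a (pivot d).
Proof.
have i1_neq_i2 : i1 != i2 by apply: contraTneq a1_gt0 => ->; rewrite -leNgt ltW.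
rewrite /shift /pivot; have [->|d_neq] := eqVneq d i1.
  by rewrite !completion_neq ?eqxx ?orbT ?mulr1 // eq_sym.
by rewrite !completion_neq ?eqxx ?orbT ?mulr1 // eq_sym.
Qed.

Lemma shift_base_neq0 d : shift d i0 != 0.
Proof. by rewrite (shift_agree d).2 /pivot; case: ifP; lia. Qed.

Lemma norm_shift_le d l : `|shift d l| <= alpha.
Proof. by rewrite -[leRHS]mulr1 norm_completion_le // => j; case: (_ || _). Qed.

Definition weight_product : int := pos_mass a others * neg_mass a others.

Lemma weight_others_bounds l :
  0 < weight a others l <= alpha /\ 0 < coweight a others l <= alpha.
Proof.
split; first exact: (weight_bounds (i := i1) (j := i2)).
exact: (coweight_bounds (i := i1) (j := i2)).
Qed.

Lemma weight_product_gt0 : 0 < weight_product.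
Proof.
rewrite /weight_product -(weightM a _ i0).
by have [/andP[? _] /andP[? _]] := weight_others_bounds i0; apply: mulr_gt0.
Qed.

Definition grid_size : nat := (#|J| * 2 * #|J|).+1.
Local Notation grid := {ffun J -> 'I_grid_size}.

(* [base_ratio] makes the first term of [grid_point] exceed the other two, and
   [scale_ratio] makes the entry at [i2] dominate the other entries of the tuple
   that [exchange_family] completes. *)
Definition base_ratio : int := (#|J|.+1)%:Z * alpha + 1.
Definition grid_ratio : int := (base_ratio + (#|J|.+1)%:Z) * alpha.
Definition scale_ratio : int := alpha * grid_ratio.
Definition scale (g : grid) : int := scale_ratio ^+ (\sum_d g d)%N.
Definition max_scale : int := scale_ratio ^+ (#|J| * grid_size)%N.
Definition level (g : grid) : int := weight_product * scale g.
Definition max_level : int := weight_product * max_scale.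

Lemma grid_ratio_ge1 : 1 <= grid_ratio.
Proof. by rewrite /grid_ratio /base_ratio; nia. Qed.

Lemma scale_ratio_ge1 : 1 <= scale_ratio.
Proof. by rewrite mulr_ege1 ?grid_ratio_ge1. Qed.

Lemma scale_bounds g : 0 < scale g <= max_scale.
Proof.
rewrite exprn_gt0 ?(lt_le_trans _ scale_ratio_ge1) //=.
rewrite ler_weXn2l ?scale_ratio_ge1 //.
by rewrite -sum_nat_const leq_sum // => d _; apply: ltnW.
Qed.

Lemma level_bounds g : 0 < level g <= max_level.
Proof.
have /andP[sc_gt0 sc_le] := scale_bounds g; have wp_gt0 := weight_product_gt0.
by rewrite mulr_gt0 // ler_pM2l.
Qed.

Lemma level_relocate_le g d (t t' : 'I_grid_size) : (t < t')%N ->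
  scale_ratio * level (relocate g d t) <= level (relocate g d t').
Proof.
move=> lt_t; rewrite /level mulrCA ler_pM2l ?weight_product_gt0 //.
rewrite -exprS ler_weXn2l ?scale_ratio_ge1 //.
rewrite (bigD1 d) //= [X in (_ <= X)%N](bigD1 d) //= !ffunE eqxx.
rewrite -addSn leq_add //.
by apply: leq_sum => e /negbTE ed; rewrite !ffunE ed.
Qed.

Definition family_ratio : int := alpha * (max_level * grid_ratio).

Section Families.

Variable m : nat.
Local Notation M := (m.+1%:Z).
Local Notation params := {ffun J + J * 'I_grid_size -> 'I_m.+1}.
Implicit Types (w : params) (g : grid) (d l : J) (t : 'I_grid_size).

Definition grid_point w g l : int :=
  base_ratio * M * weight a predT l
  + completion a i0 (fun j => (w (inl j))%:Z) l
  + \sum_d (w (inr (d, g d)))%:Z * shift d l.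

Lemma grid_point_solution w g : \sum_l a l * grid_point w g l = 0.
Proof.
under eq_bigr do rewrite /grid_point 2!mulrDr mulr_sumr.
rewrite !big_split /= completion_solution solution_scale ?weight_solution //.
by rewrite exchange_big big1 // => d _; apply/solution_scale/shift_solution.
Qed.

Lemma grid_point_bounds w g l : M <= grid_point w g l <= grid_ratio * M.
Proof.
have w_le i : `|(w i)%:Z| <= M by have := ltn_ord (w i); lia.
have completion_le := norm_completion_le a i0 l (fun j => w_le (inl j)).
have shifts_le :
    `|\sum_d (w (inr (d, g d)))%:Z * shift d l| <= #|J|%:Z * alpha * M.
  apply: le_trans (ler_norm_sum _ _ _) _.
  rewrite -mulrA -natz mulr_natl -sumr_const ler_sum // => d _.
  by rewrite normrM mulrC ler_pM ?norm_shift_le.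
have /andP[wt_gt0 wt_le] :=
  @weight_bounds _ _ a predT i0 i2 l isT a0_gt0 isT a2_lt0.
have base_gt0 : 0 < base_ratio * M by rewrite mulr_gt0 // /base_ratio; nia.
have : base_ratio * M * 1 <= base_ratio * M * weight a predT l
    <= base_ratio * M * alpha.
  by rewrite !ler_pM2l ?wt_le ?andbT.
move: completion_le shifts_le.
rewrite /grid_point !ler_norml /grid_ratio /base_ratio.
by set x := completion _ _ _ _; set y := \sum_d _; set z := weight _ _ _; lia.
Qed.

(* The factor makes the entries at [i0] and [d] equal to [a i0] times the end
   points of the segments of [segment_point]. *)
Definition grid_family g w l : int := a i0 * (level g * grid_point w g l).

Definition gap w g d : int := grid_point w g d - grid_point w g i0.

Lemma eq_gap w w' g g' d :
  (forall l, w (inl l) = w' (inl l)) ->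
  (forall e, e != d -> w (inr (e, g e)) = w' (inr (e, g' e))) ->
  gap w g d = gap w' g' d.
Proof.
move=> eq_inl eq_inr.
have completion_eq l : completion a i0 (fun j => (w (inl j))%:Z) l =
    completion a i0 (fun j => (w' (inl j))%:Z) l.
  by apply: eq_completion => j; rewrite eq_inl.
rewrite /gap /grid_point !completion_eq.
rewrite (bigD1 d) //= [X in _ - (_ + X)](bigD1 d) //=.
rewrite [X in _ = _ + X - _](bigD1 d) //= [X in _ = _ - (_ + X)](bigD1 d) //=.
have eq_rest l : \sum_(e | e != d) (w (inr (e, g e)))%:Z * shift e l =
    \sum_(e | e != d) (w' (inr (e, g' e)))%:Z * shift e l.
  by apply: eq_bigr => e ed; rewrite eq_inr.
by rewrite !eq_rest (shift_agree d).1 (shift_agree d).2; ring.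
Qed.

Definition segment_point w g d t l (s : nat) : int :=
  level (relocate g d t) * grid_point w (relocate g d t) i0
  + (weight a others l * gap w g d) *+ s.

Definition segment_steps g d t l : nat :=
  `|(coweight a others l * scale (relocate g d t))%R|%N.

Lemma segment_stepsE g d t l :
  (segment_steps g d t l)%:Z = coweight a others l * scale (relocate g d t).
Proof.
rewrite /segment_steps gez0_abs //.
have [_ /andP[/ltW cw_ge0 _]] := weight_others_bounds l.
by have /andP[/ltW sc_ge0 _] := scale_bounds (relocate g d t); rewrite mulr_ge0.
Qed.

Lemma segment_pointE w g d t l s : segment_point w g d t l s =
  weight a others l *
    (((segment_steps g d t l)%:Z - s%:Z) * grid_point w (relocate g d t) i0
     + s%:Z * grid_point w (relocate g d t) d).
Proof.
rewrite /segment_point (@eq_gap w w g (relocate g d t)) // => [|e /negbTE ed].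
  rewrite segment_stepsE /level /weight_product -(weightM a _ l) /gap.
  by rewrite -mulr_natr natz; ring.
by rewrite ffunE ed.
Qed.

Lemma segment_point_last w g d t l :
  segment_point w g d t l (segment_steps g d t l) =
  level (relocate g d t) * grid_point w (relocate g d t) d.
Proof.
rewrite segment_pointE subrr mul0r add0r segment_stepsE.
by rewrite /level /weight_product -(weightM a _ l) !mulrA.
Qed.

Lemma segment_point_bounds w g d t l s : (s <= segment_steps g d t l)%N ->
  level (relocate g d t) * M <= segment_point w g d t l s
    <= level (relocate g d t) * (grid_ratio * M).
Proof.
move=> s_le; rewrite segment_pointE.
have levelE x : level (relocate g d t) * x =
    weight a others l * ((segment_steps g d t l)%:Z * x).
  by rewrite segment_stepsE /level /weight_product -(weightM a _ l) !mulrA.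
have [/andP[wt_gt0 _] _] := weight_others_bounds l.
by rewrite !levelE !ler_pM2l // barycenter_bounds ?grid_point_bounds ?lez_nat.
Qed.

Lemma segment_point_gt0 w g d t l s : (s <= segment_steps g d t l)%N ->
  0 < segment_point w g d t l s.
Proof.
move=> /(segment_point_bounds w)/andP[+ _]; apply: lt_le_trans.
by have /andP[level_gt0 _] := level_bounds (relocate g d t); rewrite mulr_gt0.
Qed.

Lemma grid_family_bounds g w l : 0 < grid_family g w l <= family_ratio * M.
Proof.
have /andP[level_gt0 level_le] := level_bounds g.
have /andP[point_ge point_le] := grid_point_bounds w g l.
have point_gt0 : 0 < grid_point w g l by apply: lt_le_trans point_ge.
have value_gt0 : 0 < level g * grid_point w g l by apply: mulr_gt0.
have a0_le : a i0 <= alpha by have := norm_coef_le a i0; lia.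
rewrite /grid_family mulr_gt0 //= /family_ratio -[leRHS]mulrA.
by rewrite ler_pM ?(ltW a0_gt0) ?(ltW value_gt0) // -[leRHS]mulrA ler_pM // ltW.
Qed.

Lemma grid_family_determines g : determines #|J|.-1 (@grid_family g).
Proof.
rewrite -(cardsC1 i0); apply: (determines_entries (h := inl)) => [l l' []//|].
move=> w w' eq_fam eq_off l; rewrite in_setC1 => li0.
have eq_inr e : w (inr e) = w' (inr e) by apply: eq_off; apply/imsetP => -[].
have fac_neq0 : a i0 * level g != 0.
  by have /andP[level_gt0 _] := level_bounds g; rewrite mulf_neq0 ?lt0r_neq0.
move: (eq_fam l); rewrite /grid_family mulrA [RHS]mulrA.
move=> /(mulfI fac_neq0); rewrite /grid_point !completion_neq //.
under eq_bigr do rewrite eq_inr.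
by move=> /addIr /addrI /(mulfI (lt0r_neq0 a0_gt0)) [] /val_inj.
Qed.

Lemma grid_family_solutions g : solution_family a family_ratio (grid_family g).
Proof.
split=> [w|w l|].
- by do 2!apply: solution_scale; apply: grid_point_solution.
- exact: grid_family_bounds.
- exact: grid_family_determines.
Qed.

Section ExchangeFamily.

Variables (d : J) (g : grid) (f : J -> 'I_grid_size) (s : J -> nat).
Hypothesis f_inj : injective f.
Hypothesis f_lt : forall l, l != i2 -> (f l < f i2)%N.
Hypothesis s_le : forall l, (s l <= segment_steps g d (f l) l)%N.

Definition exchange_family w : J -> int :=
  completion a i0 (fun j => segment_point w g d (f j) j (s j)).

Lemma exchange_family_pivot_gt0 w : 0 < exchange_family w i0.
Proof.
have seg_gt0 l := segment_point_gt0 w (s_le l).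
rewrite /exchange_family completion_pivot oppr_gt0.
apply: (@dominated_lincomb_lt0 _ _ _ _ _ i2) => // l _ /f_lt lt_f.
have /andP[level_gt0 _] := level_bounds (relocate g d (f l)).
have /andP[seg_ge _] := segment_point_bounds w (s_le i2).
have /andP[_ seg_le] := segment_point_bounds w (s_le l).
have level_le := level_relocate_le g d lt_f.
apply: (@le_trans _ _ (segment_point w g d (f i2) i2 (s i2))); last first.
  by rewrite ler_peMl ?(ltW (seg_gt0 _)) //; lia.
rewrite gtr0_norm //; apply: le_trans seg_ge.
apply: (@le_trans _ _ (scale_ratio * level (relocate g d (f l)) * M)).
  have -> : scale_ratio * level (relocate g d (f l)) * M =
      alpha * (level (relocate g d (f l)) * (grid_ratio * M)).
    by rewrite /scale_ratio; ring.
  by rewrite ler_pM2l.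
by rewrite ler_pM2r.
Qed.

Lemma exchange_family_bounds w l : 0 < exchange_family w l <= family_ratio * M.
Proof.
have seg_gt0 j := segment_point_gt0 w (s_le j); apply/andP; split.
  have [->|li0] := eqVneq l i0; first exact: exchange_family_pivot_gt0.
  by rewrite /exchange_family completion_neq ?mulr_gt0.
apply: le_trans (ler_norm _) _.
rewrite /family_ratio -mulrA norm_completion_le // => j; rewrite gtr0_norm //.
have /andP[_ level_le] := level_bounds (relocate g d (f j)).
have /andP[_ seg_le] := segment_point_bounds w (s_le j).
apply: le_trans seg_le _.
by rewrite mulrA ler_wpM2r // ler_wpM2r // (le_trans _ grid_ratio_ge1).
Qed.

Lemma exchange_family_determines : determines #|J|.-1 exchange_family.
Proof.
rewrite -(cardsC1 i0).
apply: (determines_entries (h := fun l => inr (d, f l))) => [l l' [/f_inj]//|].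
move=> w w' eq_fam eq_off l; rewrite in_setC1 => li0.
have eq_inl j : w (inl j) = w' (inl j) by apply: eq_off; apply/imsetP => -[].
have eq_inr e t : e != d -> w (inr (e, t)) = w' (inr (e, t)).
  by move=> /eqP ed; apply: eq_off; apply/imsetP => -[? _ [/ed]].
move: (eq_fam l); rewrite /exchange_family !completion_neq // /segment_point.
rewrite (@eq_gap w w' g g) // => [|e]; last exact: eq_inr.
move=> /(mulfI (lt0r_neq0 a0_gt0)) /addIr.
have /andP[level_gt0 _] := level_bounds (relocate g d (f l)).
move=> /(mulfI (lt0r_neq0 level_gt0)).
have completion_eq : completion a i0 (fun j => (w (inl j))%:Z) i0 =
    completion a i0 (fun j => (w' (inl j))%:Z) i0.
  by apply: eq_completion => j; rewrite eq_inl.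
rewrite /grid_point completion_eq.
rewrite (bigD1 d) //= [X in _ = _ + X](bigD1 d) //= ffunE eqxx.
under eq_bigr => e ed do rewrite eq_inr //.
by move=> /addrI /addIr /(mulIf (shift_base_neq0 d)) [] /val_inj.
Qed.

Lemma exchange_family_solutions :
  solution_family a family_ratio exchange_family.
Proof.
split=> [w|w l|]; first exact: completion_solution.
- exact: exchange_family_bounds.
- exact: exchange_family_determines.
Qed.

End ExchangeFamily.

Definition max_steps : nat := `|(alpha * max_scale)%R|%N.

Lemma segment_steps_le g d t l : (segment_steps g d t l <= max_steps)%N.
Proof.
have [_ /andP[/ltW cw_ge0 cw_le]] := weight_others_bounds l.
have /andP[/ltW sc_ge0 sc_le] := scale_bounds (relocate g d t).
rewrite -lez_nat segment_stepsE /max_steps abszE; apply: le_trans (ler_norm _).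
exact: ler_pM.
Qed.

Definition label : finType :=
  (grid +
   J * grid * {ffun J -> 'I_grid_size} * {ffun J -> 'I_max_steps.+1})%type.

Definition family (lab : label) : params -> J -> int :=
  match lab with
  | inl g => grid_family g
  | inr (d, g, f, s) => exchange_family d g f (fun l => s l)
  end.

Lemma unicolored_exchange_family (col : int -> bool) w g d
    (f : {ffun J -> 'I_grid_size}) (r : bool) :
  injective f -> (forall l, l != i2 -> (f l < f i2)%N) ->
  (forall l, let x := grid_family (relocate g d (f l)) w in
     col (x i0) = r /\ col (x d) = ~~ r) ->
  exists2 lab, solution_family a family_ratio (family lab) &
    unicolored col (family lab w).
Proof.
move=> f_inj f_lt ends.
have [||s s_le [r' s_col]] := @unicolored_completion _ _ a col i0
    (fun l => segment_point w g d (f l) l 0)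
    (fun l => weight a others l * gap w g d)
    (fun l => segment_steps g d (f l) l) r.
- under eq_bigr do rewrite mulrA.
  by rewrite -mulr_suml weight_solution mul0r.
- move=> l; have [col_i0 col_d] := ends l; split.
    by rewrite /segment_point mulr0n addr0.
  rewrite /segment_point mulr0n addr0 -/(segment_point _ _ _ _ _ _).
  by rewrite segment_point_last.
pose s' := [ffun l => inord (s l) : 'I_max_steps.+1].
have s'E l : s' l = s l :> nat.
  by rewrite ffunE inordK // ltnS (leq_trans (s_le l)) // segment_steps_le.
exists (inr (d, g, f, s')) => /=.
  by apply: exchange_family_solutions => // l; rewrite s'E.
exists r' => l; rewrite -(s_col l); congr col; apply: eq_completion => j.
by rewrite s'E /segment_point mulr0n addr0.
Qed.

Lemma exists_unicolored_family (col : int -> bool) w :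
  exists2 lab, solution_family a family_ratio (family lab) &
    unicolored col (family lab w).
Proof.
have [g /forallP g_col|no_g] := pickP (fun g =>
    [forall l, col (grid_family g w l) == col (grid_family g w i0)]).
  exists (inl g); first exact: grid_family_solutions.
  by exists (col (grid_family g w i0)) => l; apply/eqP/g_col.
have /fin_all_exists[mismatch mismatch_col] : forall g, exists l,
    col (grid_family g w l) != col (grid_family g w i0).
  by move=> g; apply/existsP; rewrite -negb_forall no_g.
have [|[d r] [g]] := @exists_line_repeating_value J 'I_grid_size (J * bool)%type
    (fun g => (mismatch g, col (grid_family g w i0))) fst #|J|.
  by rewrite card_prod card_bool card_ord.
move=> /ltnW /(injection_maximal_at i2)[f [f_inj f_mem f_lt]].
apply: (@unicolored_exchange_family col w g d f r) => // l.
have := f_mem l; rewrite inE /= => /eqP[mismatch_d <-].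
have := mismatch_col (relocate g d (f l)); rewrite mismatch_d.
by case: (col _); case: (col _).
Qed.

End Families.
End Configuration.

Lemma exists_elt (n : nat) (z : int) :
  0 < z <= n%:Z -> exists i : 'I_n, elt i = z.
Proof.
case: z => [[|z]|] //= lt_z; have lt_zn : (z < n)%N by lia.
by exists (Ordinal lt_zn).
Qed.

Lemma exists_extension (n : nat) (c : 'I_n -> bool) :
  exists col : int -> bool, forall i, col (elt i) = c i.
Proof.
exists (fun z => if insub `|z|%N.-1 is Some i then c i else false) => i.
by rewrite /elt /= valK.
Qed.

Lemma card_mono_solutions_ge (k : nat) (a : 'I_k -> int) (I L : finType)
    (m n : nat) (C : int) (c : 'I_n -> bool)
    (x : L -> {ffun I -> 'I_m.+1} -> 'I_k -> int) :
  C * m.+1%:Z <= n%:Z ->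
  (forall (col : int -> bool) w, exists2 lab, solution_family a C (x lab) &
     unicolored col (x lab w)) ->
  (m.+1 ^ k.-1 <= #|L| * #|mono_solutions a c|)%N.
Proof.
move=> le_n covered; have [col colE] := exists_extension c.
have := @leq_card_determines _ _ _ _ _ _ #|'I_k|.-1 x
  (fun (y : {ffun 'I_k -> 'I_n}) l => elt (y l)) (mono_solutions a c).
rewrite !card_ord; apply=> // w.
have [lab [sol bounds det] [r lab_r]] := covered col w.
exists lab; first by rewrite card_ord in det.
have /fin_all_exists[y y_val] l : exists i : 'I_n, elt i = x lab w l.
  apply: exists_elt; have /andP[-> le] := bounds w l; exact: le_trans le_n.
exists (finfun y) => [|l]; last by rewrite ffunE y_val.
rewrite inE; apply/andP; split.
  by rewrite /is_solution; under eq_bigr do rewrite ffunE y_val; rewrite sol.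
by apply/forallP => i; apply/forallP => j; rewrite !ffunE -!colE !y_val !lab_r.
Qed.

Definition mono_abundant (k : nat) (a : 'I_k -> int) : Prop :=
  exists C L : nat, forall (m n : nat) (c : 'I_n -> bool),
    (C * m.+1 <= n)%N -> (m.+1 ^ k.-1 <= L * #|mono_solutions a c|)%N.

Lemma mono_abundant_two_pos (k : nat) (a : 'I_k -> int) (i0 i1 i2 : 'I_k) :
  i1 != i0 -> 0 < a i0 -> 0 < a i1 -> a i2 < 0 -> mono_abundant a.
Proof.
move=> i1_neq_i0 a0_gt0 a1_gt0 a2_lt0.
exists `|family_ratio a i0|%N, #|label a| => m n c le_n.
apply: (card_mono_solutions_ge (C := family_ratio a i0)) => [|col w].
  by nia.
exact: (exists_unicolored_family a0_gt0 a1_gt0 a2_lt0 i1_neq_i0).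
Qed.

Lemma mono_solutions_opp (k n : nat) (a : 'I_k -> int) (c : 'I_n -> bool) :
  mono_solutions (fun i => - a i) c = mono_solutions a c.
Proof.
apply/setP => x; rewrite !inE /is_solution.
by under eq_bigr do rewrite mulNr; rewrite sumrN oppr_eq0.
Qed.

Lemma mono_abundant_mixed_signs (k : nat) (a : 'I_k -> int) :
  (3 <= k)%N -> (forall i, a i != 0) ->
  (exists i, 0 < a i) -> (exists i, a i < 0) -> mono_abundant a.
Proof.
move=> k_ge3 a_neq0 [i ai_gt0] [j aj_lt0].
have /card_gt0P[l] : (0 < #|~: [set i; j]|)%N.
  by rewrite cardsCs setCK card_ord cards2; case: (_ != _); lia.
rewrite !inE negb_or => /andP[li lj].
have [al_gt0|al_lt0|/eqP] := ltrgt0P (a l); last by rewrite (negbTE (a_neq0 l)).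
  exact: mono_abundant_two_pos li ai_gt0 al_gt0 aj_lt0.
have [||| C [L count]] := @mono_abundant_two_pos k (fun i => - a i) j l i lj;
  rewrite ?oppr_gt0 ?oppr_lt0 //.
by exists C, L => m n c le_n; rewrite -(mono_solutions_opp a c); apply: count.
Qed.

Lemma power_lower_bound_of_scales (R : numFieldType) (d C L : nat) :
  exists2 delta : R, 0 < delta & forall n s : nat, (C < n)%N ->
    (forall m, (C * m.+1 <= n)%N -> (m.+1 ^ d <= L * s)%N) ->
    delta * n%:R ^+ d <= s%:R.
Proof.
pose B := (2 * C.+1)%N; pose D := (B ^ d * L.+1)%N.
have D_gt0 : 0 < D%:R :> R by rewrite ltr0n muln_gt0 expn_gt0.
exists D%:R^-1 => [|n s lt_Cn scales]; first by rewrite invr_gt0.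
rewrite mulrC ler_pdivrMr // -natrX -natrM ler_nat mulnC.
have [m /andP[le_n n_le]] : exists m, (C * m.+1 <= n <= B * m.+1)%N.
  have q_gt0 : (0 < n %/ C.+1)%N by rewrite divn_gt0.
  exists (n %/ C.+1).-1; rewrite prednK // /B.
  by have := divn_eq n C.+1; have := ltn_pmod n (ltn0Sn C); nia.
apply: (@leq_trans ((B * m.+1) ^ d)).
  by have [->|d_gt0] := posnP d; rewrite ?expn0 ?leq_exp2r.
rewrite expnMn -mulnA leq_mul2l; apply/orP; right.
by apply: leq_trans (scales m le_n) _; rewrite leq_mul2r leqnSn orbT.
Qed.

Theorem theorem1p2 (R : realType) (k : nat) (a : 'I_k -> int)
    (hk : (3 <= k)%N)
    (ha : forall i, a i != 0)
    (hpos : exists i, 0 < a i)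
    (hneg : exists i, a i < 0) :
  exists2 delta : R, 0 < delta &
    exists N : nat, forall n : nat, (N <= n)%N ->
      forall c : 'I_n -> bool,
        delta * n%:R ^+ (k - 1) <= #|mono_solutions a c|%:R.
Proof.
have [C [L count]] := mono_abundant_mixed_signs hk ha hpos hneg.
have [delta delta_gt0 lower_bound] := power_lower_bound_of_scales R (k - 1) C L.
exists delta => //; exists C.+1 => n lt_Cn c; apply: lower_bound => // m le_n.
by rewrite subn1; apply: count.
Qed.
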